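(* Let $\mathscr A$ be a $C^*$-algebra and $\mathscr E$ a Hilbert $\mathscr A$-module. Let $\mathscr H$ and $\mathscr K$ be closed submodules of $\mathscr E$ such that $\mathscr H\cap\mathscr K$ is an orthogonally complemented submodule of $\mathscr E$. Let $\omega_1,\ldots,\omega_n$ be positive linear functionals on $\mathscr A$. If $(\mathscr H\cap\mathscr K)_{\omega_j}=\mathscr H_{\omega_j}\cap\mathscr K_{\omega_j}$ for each $j=1,\ldots,n$, then $$(\mathscr H\cap\mathscr K)_\omega=\mathscr H_\omega\cap\mathscr K_\omega$$ for all $\omega$ in the convex hull of $\{\omega_1,\ldots,\omega_n\}$.
   Context: For a positive linear functional $\omega$ on $\mathscr A$, put $\mathscr N_\omega=\{x\in\mathscr E:\omega(\langle x,x\rangle)=0\}$, a closed subspace of $\mathscr E$. The quotient $\mathscr E/\mathscr N_\omega$ carries the inner product $(x+\mathscr N_\omega,y+\mathscr N_\omega)_\omega:=\omega(\langle x,y\rangle)$; $\mathscr E_\omega$ denotes its Hilbert space completion, and $\iota_\omega:\mathscr E\to\mathscr E_\omega$ is the map $\iota_\omega(x)=x+\mathscr N_\omega$. For a closed submodule $\mathscr L$ of $\mathscr E$, the localization $\mathscr L_\omega$ is identified with the closed subspace $\overline{\iota_\omega(\mathscr L)}$ (norm closure) of $\mathscr E_\omega$; the equalities and intersections in the claim are between closed subspaces of $\mathscr E_{\omega_j}$, respectively $\mathscr E_\omega$. A closed submodule $\mathscr L$ of $\mathscr E$ is orthogonally complemented if $\mathscr E=\mathscr L\oplus\mathscr L^\perp$,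 where $\mathscr L^\perp=\{x\in\mathscr E:\langle x,l\rangle=0\text{ for all }l\in\mathscr L\}$. *)

(* Defs.v *)
From HB Require Import structures.
From mathcomp Require Import all_boot all_order all_algebra generic_quotient.
From mathcomp Require Import ring_quotient complex ring lra.
From mathcomp Require Import boolp classical_sets functions reals.
From mathcomp Require Import interval_inference convex topology normedtype.
From mathcomp Require Import sequences.

Set Implicit Arguments.
Unset Strict Implicit.
Unset Printing Implicit Defensive.

Import Order.TTheory GRing.Theory Num.Theory.
Import numFieldNormedType.Exports.

Local Open Scope classical_set_scope.
Local Open Scope ring_scope.

(* C*-algebras need not be unital, so the product is not the one of MathComp's
   (unital) rings.  Norms over R[i] take their values in R[i]. *)
HB.mixin Record isCstarAlgebra (R : realType) A
    of CompleteNormedModule R[i] A := {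
  cmul : A -> A -> A ;
  star : A -> A ;
  cmulA : associative cmul ;
  cmulDl : left_distributive cmul +%R ;
  cmulDr : right_distributive cmul +%R ;
  cmulZl : forall (k : R[i]) (a b : A), cmul (k *: a) b = k *: cmul a b ;
  cmulZr : forall (k : R[i]) (a b : A), cmul a (k *: b) = k *: cmul a b ;
  ler_norm_cmul : forall a b : A, `|cmul a b| <= `|a| * `|b| ;
  starK : involutive star ;
  starD : {morph star : a b / a + b} ;
  starZ : forall (k : R[i]) (a : A), star (k *: a) = k^* *: star a ;
  star_cmul : forall a b : A, star (cmul a b) = cmul (star b) (star a) ;
  norm_cstar : forall a : A, `|cmul (star a) a| = `|a| ^+ 2
}.

#[short(type="cstarAlgType")]
HB.structure Definition CstarAlgebra (R : realType) :=
  {A of isCstarAlgebra R A & CompleteNormedModule R[i] A}.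

Definition cstar_ge0 (R : realType) (A : cstarAlgType R) : set A :=
  [set a | exists b : A, a = cmul (star b) b].

(* Right modules, with an A-valued inner product that is linear in its second
   argument.  Definiteness of the inner product follows from sqr_norm_ip. *)
HB.mixin Record isHilbertModule (R : realType) (A : cstarAlgType R) E
    of CompleteNormedModule R[i] E := {
  ract : E -> A -> E ;
  ip : E -> E -> A ;
  ractDl : forall (x y : E) (a : A), ract (x + y) a = ract x a + ract y a ;
  ractDr : forall (x : E) (a b : A), ract x (a + b) = ract x a + ract x b ;
  ractA : forall (x : E) (a b : A), ract x (cmul a b) = ract (ract x a) b ;
  ractZl : forall (k : R[i]) (x : E) (a : A), ract (k *: x) a = k *: ract x a ;
  ractZr : forall (k : R[i]) (x : E) (a : A), ract x (k *: a) = k *: ract x a ;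
  ipDr : forall x y z : E, ip x (y + z) = ip x y + ip x z ;
  ipZr : forall (k : R[i]) (x y : E), ip x (k *: y) = k *: ip x y ;
  ip_ract : forall (x y : E) (a : A), ip x (ract y a) = cmul (ip x y) a ;
  star_ip : forall x y : E, star (ip x y) = ip y x ;
  ip_ge0 : forall x : E, cstar_ge0 (ip x x) ;
  sqr_norm_ip : forall x : E, `|x| ^+ 2 = `|ip x x|
}.

#[short(type="hilbertModType")]
HB.structure Definition HilbertModule (R : realType) (A : cstarAlgType R) :=
  {E of isHilbertModule R A E & CompleteNormedModule R[i] E}.

Section Submodules.
Context {R : realType} {A : cstarAlgType R} {E : hilbertModType A}.
Implicit Types L M : set E.

Definition closed_submodule L :=
  [/\ L 0,
      forall (k : R[i]) (x y : E), L x -> L y -> L (k *: x + y),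
      forall (x : E) (a : A), L x -> L (ract x a)
    & closed L].

Definition orthogonal_complement L : set E :=
  [set x | forall l, L l -> ip x l = 0].

Definition direct_sum L M : Prop :=
  (forall x, exists l m, [/\ L l, M m & x = l + m]) /\ L `&` M = [set 0].

Definition orthogonally_complemented L :=
  direct_sum L (orthogonal_complement L).

End Submodules.

Record positive_functional (R : realType) (A : cstarAlgType R) :=
  PositiveFunctional {
  functional :> {scalar A} ;
  functional_ge0 : forall a : A, cstar_ge0 a -> 0 <= functional a
}.

(* For K = R[i], the coefficients in convex_set satisfy 0 <= t <= 1 in R[i],
   and thus are real. *)
Definition convex_hull (K : numDomainType) (V : lmodType K) (S : set V)
  : set V := smallest (@convex_set K V) S.

HB.mixin Record hasInnerProduct (R : realType) V of NormedModule R[i] V := {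
  dot : V -> V -> R[i] ;
  dotDr : forall x y z : V, dot x (y + z) = dot x y + dot x z ;
  dotZr : forall (k : R[i]) (x y : V), dot x (k *: y) = k * dot x y ;
  dotC : forall x y : V, (dot x y)^* = dot y x ;
  sqr_norm_dot : forall x : V, `|x| ^+ 2 = dot x x
}.

#[short(type="preHilbertType")]
HB.structure Definition PreHilbert (R : realType) :=
  {V of hasInnerProduct R V & NormedModule R[i] V}.

#[short(type="hilbertType")]
HB.structure Definition Hilbert (R : realType) :=
  {V of PreHilbert R V & Complete V}.

Record semi_inner_product (R : realType) (V : lmodType R[i]) :=
  SemiInnerProduct {
  sdot :> V -> V -> R[i] ;
  sdotDr : forall x y z : V, sdot x (y + z) = sdot x y + sdot x z ;
  sdotZr : forall (k : R[i]) (x y : V), sdot x (k *: y) = k * sdot x y ;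
  sdotC : forall x y : V, (sdot x y)^* = sdot y x ;
  sdot_ge0 : forall x : V, 0 <= sdot x x
}.

Section SemiInnerProductTheory.
Context {R : realType} {V : lmodType R[i]} (B : semi_inner_product V).
Implicit Types (x y z : V) (k : R[i]).

Lemma sdotDl x y z : B (x + y) z = B x z + B y z.
Proof. by rewrite -sdotC sdotDr rmorphD /= !sdotC. Qed.

Lemma sdotZl k x y : B (k *: x) y = k^* * B x y.
Proof. by rewrite -sdotC sdotZr rmorphM /= sdotC. Qed.

Lemma sdotNr x y : B x (- y) = - B x y.
Proof. by rewrite -scaleN1r sdotZr mulN1r. Qed.

Lemma sdotNl x y : B (- x) y = - B x y.
Proof. by rewrite -sdotC sdotNr rmorphN /= sdotC. Qed.

Lemma sdot0r x : B x 0 = 0.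
Proof. by rewrite -(scale0r 0) sdotZr mul0r. Qed.

Lemma sdot0l x : B 0 x = 0.
Proof. by rewrite -sdotC sdot0r rmorph0. Qed.

Lemma sdot_CauchySchwarz x y : `|B x y| ^+ 2 <= B x x * B y y.
Proof.
have H u v : 0 <= B v v * (B u u * B v v - `|B u v| ^+ 2).
  have := sdot_ge0 B (B v v *: u - B v u *: v).
  rewrite !(sdotDr, sdotDl, sdotNr, sdotNl, sdotZr, sdotZl) !sdotC normCK sdotC.
  by congr (0 <= _); ring.
have [y0|y0] := eqVneq (B y y) 0; last first.
  have := H x y; rewrite pmulr_rge0 ?subr_ge0 //.
  by rewrite lt_def y0 sdot_ge0.
have [x0|x0] := eqVneq (B x x) 0; last first.
  have := H y x; rewrite pmulr_rge0 ?subr_ge0 1?mulrC //; last first.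
    by rewrite lt_def x0 sdot_ge0.
  by rewrite -[B x y]sdotC norm_conjC.
have := sdot_ge0 B (x - B y x *: y).
rewrite !(sdotDr, sdotDl, sdotNr, sdotNl, sdotZr, sdotZl) !sdotC x0 y0 normCK sdotC.
rewrite !(mulr0, oppr0, addr0, add0r) mulrC -opprD -mulr2n oppr_ge0.
by rewrite pmulrn_lle0 // => h; exact: h.
Qed.

Definition snorm x : R[i] := sqrtC (B x x).

Lemma snorm_ge0 x : 0 <= snorm x.
Proof. by rewrite sqrtC_ge0 sdot_ge0. Qed.

Lemma sqr_snorm x : snorm x ^+ 2 = B x x.
Proof. by rewrite sqrtCK. Qed.

Lemma norm_sdot x y : `|B x y| <= snorm x * snorm y.
Proof.
rewrite -(@ler_pXn2r _ 2) ?nnegrE ?mulr_ge0 ?snorm_ge0 //.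
by rewrite exprMn !sqr_snorm sdot_CauchySchwarz.
Qed.

Lemma snormD x y : snorm (x + y) <= snorm x + snorm y.
Proof.
rewrite -(@ler_pXn2r _ 2) ?nnegrE ?addr_ge0 ?snorm_ge0 //.
rewrite sqr_snorm sqrrD !sqr_snorm sdotDr !sdotDl -addrA -[leRHS]addrA lerD2l.
rewrite addrA -[leRHS]addrC [leRHS]addrC lerD2r.
rewrite mulr2n.
have hr : B y x + B x y \is Num.real.
  by apply/CrealP; rewrite rmorphD /= !sdotC addrC.
apply: le_trans (real_ler_norm hr) _.
apply: le_trans (ler_normD _ _) _.
by rewrite lerD // ?norm_sdot // mulrC norm_sdot.
Qed.

Lemma snormZ k x : snorm (k *: x) = `|k| * snorm x.
Proof.
apply/eqP; rewrite -(@eqrXn2 _ 2) ?mulr_ge0 ?snorm_ge0 //; apply/eqP.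
by rewrite exprMn !sqr_snorm sdotZr sdotZl normCK mulrA.
Qed.

Definition null_space : {pred V} := [pred x | B x x == 0].

Lemma null_spaceP x : reflect (forall y, B x y = 0) (x \in null_space).
Proof.
apply: (iffP eqP) => [x0 y|/(_ x)//].
apply/eqP; rewrite -normr_eq0 -sqrf_eq0 eq_le exprn_ge0 // andbT.
by apply: le_trans (sdot_CauchySchwarz _ _) _; rewrite x0 mul0r.
Qed.

Fact null_space_zmod_closed : zmod_closed null_space.
Proof.
split; first by apply/null_spaceP=> y; rewrite sdot0l.
move=> x y /null_spaceP x0 /null_spaceP y0; apply/null_spaceP => z.
by rewrite sdotDl sdotNl x0 y0 subrr.
Qed.

HB.instance Definition _ :=
  GRing.isZmodClosed.Build V null_space null_space_zmod_closed.

Definition null_quotient := Quotient.quot null_space.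

HB.instance Definition _ := GRing.Zmodule.on null_quotient.
HB.instance Definition _ := EqQuotient.on null_quotient.

Definition to_null_quotient x : null_quotient := (\pi_null_quotient x)%qT.

Fact to_null_quotient_is_additive : zmod_morphism to_null_quotient.
Proof. by move=> x y; rewrite /to_null_quotient !piE. Qed.

HB.instance Definition _ := GRing.isZmodMorphism.Build V null_quotient
  to_null_quotient to_null_quotient_is_additive.

Lemma null_quotient_surj q : exists x, q = to_null_quotient x.
Proof. by exists (repr q); rewrite /to_null_quotient reprK. Qed.

Lemma null_quotientP x y :
  reflect (forall z, B x z = B y z) (to_null_quotient x == to_null_quotient y).
Proof.
rewrite /to_null_quotient.
rewrite -Quotient.idealrBE; apply: (iffP (null_spaceP _)) => h z.
  by have /eqP := h z; rewrite sdotDl sdotNl subr_eq0 => /eqP.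
by rewrite sdotDl sdotNl h subrr.
Qed.

Let scale k (q : null_quotient) : null_quotient := to_null_quotient (k *: repr q).

Let scale_pi k x : scale k (to_null_quotient x) = to_null_quotient (k *: x).
Proof.
apply/eqP/null_quotientP => z; rewrite !sdotZl; congr (_ * _).
by move: z; apply/null_quotientP; rewrite /to_null_quotient reprK.
Qed.

Let scaleA a b q : scale a (scale b q) = scale (a * b) q.
Proof. by have [x ->] := null_quotient_surj q; rewrite !scale_pi scalerA. Qed.

Let scale1 : left_id 1 scale.
Proof.
by move=> q; have [x ->] := null_quotient_surj q; rewrite scale_pi scale1r.
Qed.

Let scaleDr : right_distributive scale +%R.
Proof.
move=> k p q; have [x ->] := null_quotient_surj p.
by have [y ->] := null_quotient_surj q; rewrite !scale_pi -!raddfD /= scale_pi scalerDr.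
Qed.

Let scaleDl q : {morph scale^~ q : a b / a + b}.
Proof.
move=> a b /=; have [x ->] := null_quotient_surj q.
by rewrite !scale_pi -raddfD /= scalerDl.
Qed.

HB.instance Definition _ := GRing.Zmodule_isLmodule.Build R[i] null_quotient
  scaleA scale1 scaleDr scaleDl.

Fact to_null_quotient_is_scalable : scalable to_null_quotient.
Proof. by move=> k x; rewrite -scale_pi. Qed.

HB.instance Definition _ := GRing.isScalable.Build R[i] V null_quotient *:%R
  to_null_quotient to_null_quotient_is_scalable.

Let qdot (p q : null_quotient) : R[i] := B (repr p) (repr q).

Let qdot_pi x y : qdot (to_null_quotient x) (to_null_quotient y) = B x y.
Proof.
have H u z : B (repr (to_null_quotient u)) z = B u z.
  by move: z; apply/null_quotientP; rewrite /to_null_quotient reprK.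
by rewrite /qdot H -sdotC H sdotC.
Qed.

Let qnorm q := sqrtC (qdot q q).

Let qnorm_pi x : qnorm (to_null_quotient x) = snorm x.
Proof. by rewrite /qnorm qdot_pi. Qed.

Let qnormD p q : qnorm (p + q) <= qnorm p + qnorm q.
Proof.
have [x ->] := null_quotient_surj p; have [y ->] := null_quotient_surj q.
by rewrite -raddfD /= !qnorm_pi snormD.
Qed.

Let qnormZ k q : qnorm (k *: q) = `|k| * qnorm q.
Proof.
by have [x ->] := null_quotient_surj q; rewrite -linearZ /= !qnorm_pi snormZ.
Qed.

Let qnorm0_eq0 q : qnorm q = 0 -> q = 0.
Proof.
have [x ->] := null_quotient_surj q; rewrite qnorm_pi => x0.
rewrite -(raddf0 to_null_quotient); apply/eqP/null_quotientP => z.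
rewrite sdot0l; move: z; apply/null_spaceP.
by rewrite inE /= -sqr_snorm x0 expr0n.
Qed.

HB.instance Definition _ :=
  Lmodule_isNormed.Build R[i] null_quotient qnormD qnormZ qnorm0_eq0.

Let qdotDr p q r : qdot p (q + r) = qdot p q + qdot p r.
Proof.
have [x ->] := null_quotient_surj p; have [y ->] := null_quotient_surj q.
by have [z ->] := null_quotient_surj r; rewrite -raddfD /= !qdot_pi sdotDr.
Qed.

Let qdotZr k p q : qdot p (k *: q) = k * qdot p q.
Proof.
have [x ->] := null_quotient_surj p; have [y ->] := null_quotient_surj q.
by rewrite -linearZ /= !qdot_pi sdotZr.
Qed.

Let qdotC p q : (qdot p q)^* = qdot q p.
Proof. exact: sdotC. Qed.

Let sqr_qnorm q : `|q| ^+ 2 = qdot q q.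
Proof. exact: sqr_snorm. Qed.

HB.instance Definition _ := hasInnerProduct.Build R null_quotient
  qdotDr qdotZr qdotC sqr_qnorm.

Lemma dot_null_quotient x y :
  dot (to_null_quotient x) (to_null_quotient y) = B x y.
Proof. exact: qdot_pi. Qed.

Lemma norm_null_quotient x : `|to_null_quotient x| = snorm x.
Proof. exact: qnorm_pi. Qed.

End SemiInnerProductTheory.

Section CauchySequences.
Context {R : realType}.
Local Notation C := R[i].

Lemma cauchy_seqPnear (V : normedModType C) (u : nat -> V) :
  cauchy (u @ \oo) <->
  forall e : C, 0 < e -> exists N, forall n m, (N <= n)%N -> (N <= m)%N ->
    `|u n - u m| < e.
Proof.
rewrite -(cauchy_ballP (u @ \oo)); split => h e e0.
  have := h e e0; rewrite near_simpl => -[[P Q] /= [[N1 _ P1] [N2 _ Q2]] PQ].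
  exists (maxn N1 N2) => n m; rewrite !geq_max => /andP[n1 _] /andP[_ m2].
  have := PQ (n, m); rewrite /= -ball_normE /=; apply; split.
    exact: P1.
  exact: Q2.
have [N uN] := h e e0; rewrite near_simpl.
exists ([set n | (N <= n)%N], [set n | (N <= n)%N]) => /=.
  by split; exists N.
move=> [n m] /= [Nn Nm]; rewrite -ball_normE /=.
exact: uN.
Qed.

Lemma Re_gt0 (e : C) : 0 < e -> 0 < complex.Re e /\ e = (complex.Re e)%:C%C.
Proof.
by case: e => a b; rewrite ltcE /= => /andP[/eqP -> a0].
Qed.

Lemma norm_Re_le (z : C) : `|complex.Re z|%:C%C <= `|z|.
Proof. exact: normc_ge_Re. Qed.

Lemma norm_Im_le (z : C) : `|complex.Im z|%:C%C <= `|z|.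
Proof.
have := normc_ge_Re (- z * 'i%C); rewrite ReiNIm raddfN opprK normrM normrN.
suff -> : `|'i%C : C| = 1 by rewrite mulr1.
by rewrite normc_def /= expr0n expr1n add0r sqrtr1.
Qed.

Lemma norm_le_ReIm (z : C) :
  `|z| <= (`|complex.Re z| + `|complex.Im z|)%:C%C.
Proof.
rewrite [z in leLHS]complexE (le_trans (ler_normD _ _)) // normrM.
rewrite rmorphD /=.
suff nR (x : R) : `|x%:C%C : C| = `|x|%:C%C.
  rewrite !nR.
  suff -> : `|'i%C : C| = 1 by rewrite mul1r.
  by rewrite normc_def /= expr0n expr1n add0r sqrtr1.
by rewrite normc_def /= expr0n addr0 sqrtr_sqr.
Qed.

Lemma cauchy_cvgC (z : nat -> C^o) : cauchy (z @ \oo) -> cvg (z @ \oo).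
Proof.
move=> /cauchy_seqPnear cz.
have H (f : C^o -> R) : {morph f : x y / x - y} ->
    (forall w, `|f w|%:C%C <= `|w|) -> cvg ((f \o z) @ \oo).
  move=> fB fle; apply: R_complete; apply/cauchy_ballP => e e0.
  have [|N zN] := cz e%:C%C; first by rewrite ltcR.
  rewrite near_simpl.
  exists ([set n | (N <= n)%N], [set n | (N <= n)%N]) => /=.
    by split; exists N.
  move=> [n m] /= [Nn Nm]; rewrite -ball_normE /=.
  by rewrite -fB -ltcR (le_lt_trans (fle _)) // zN.
have /cvg_ex[a /cvgrPdist_lt ha] := H (@complex.Re R) (@raddfB _ _ _) norm_Re_le.
have /cvg_ex[b /cvgrPdist_lt hb] := H (@complex.Im R) (@raddfB _ _ _) norm_Im_le.
apply/cvg_ex; exists (a +i* b : C^o)%C; apply/cvgrPdist_lt => e /Re_gt0[e0 eE].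
have e20 : 0 < complex.Re e / 2 by rewrite divr_gt0.
near=> n.
rewrite eE (le_lt_trans (norm_le_ReIm _)) // ltcR (splitr (complex.Re e)) ltrD //.
  rewrite raddfB /=; near: n; exact: ha.
rewrite raddfB /=; near: n; exact: hb.
Unshelve. all: by end_near. Qed.

End CauchySequences.

Section PreHilbertTheory.
Context {R : realType} {V : preHilbertType R}.
Implicit Types x y : V.

Lemma dot_ge0 x : 0 <= dot x x.
Proof. by rewrite -sqr_norm_dot exprn_ge0. Qed.

Definition dot_semi : semi_inner_product V :=
  SemiInnerProduct (@dotDr R V) (@dotZr R V) (@dotC R V) dot_ge0.

Lemma snorm_dot x : snorm dot_semi x = `|x|.
Proof. by rewrite /snorm /= -sqr_norm_dot sqrCK. Qed.

Lemma norm_dot x y : `|dot x y| <= `|x| * `|y|.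
Proof. by rewrite -!snorm_dot (norm_sdot dot_semi). Qed.

Lemma dotBB x y a b : dot x y - dot a b = dot (x - a) y + dot a (y - b).
Proof.
have := sdotDl dot_semi (x - a) a y; rewrite /= subrK => ->.
have := sdotDr dot_semi a (y - b) b; rewrite /= subrK => ->.
by rewrite addrA addrK.
Qed.

End PreHilbertTheory.

Section Completion.
Context {R : realType} (V : preHilbertType R).
Local Notation C := R[i].

Definition cauchy_sequences : {pred nat -> V} :=
  [pred u : nat -> V | `[< cauchy (u @ \oo) >]].

Lemma cauchy_sequencesP (u : nat -> V) : u \in cauchy_sequences <->
  forall e : C, 0 < e -> exists N, forall n m, (N <= n)%N -> (N <= m)%N ->
    `|u n - u m| < e.
Proof. by split => [/asboolP/cauchy_seqPnear//|h]; apply/asboolP/cauchy_seqPnear. Qed.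

Fact cauchy_sequences_submod_closed : submod_closed cauchy_sequences.
Proof.
split.
  apply/cauchy_sequencesP => e e0; exists 0%N => n m _ _.
  by rewrite subrr normr0.
move=> k u v /cauchy_sequencesP cu /cauchy_sequencesP cv.
apply/cauchy_sequencesP => e e0.
have k0 : 0 < `|k| + 1 by rewrite ltr_wpDl.
have [|N uN] := cu (e / 2 / (`|k| + 1)); first by rewrite !divr_gt0.
have [|M vM] := cv (e / 2); first by rewrite divr_gt0.
exists (maxn N M) => n m; rewrite !geq_max => /andP[n1 n2] /andP[m1 m2].
rewrite [X in `|X|](_ : _ = k *: (u n - u m) + (v n - v m)); last first.
  by rewrite scalerBr opprD addrACA.
rewrite (le_lt_trans (ler_normD _ _)) // (splitr e) ltr_leD // ?ltW ?vM //.
rewrite normrZ.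
have := uN n m n1 m1; rewrite ltr_pdivlMr // => h.
apply: le_lt_trans h; rewrite mulrC ler_wpM2l // lerDl //.
Qed.

HB.instance Definition _ := GRing.isSubmodClosed.Build C (nat -> V)
  cauchy_sequences cauchy_sequences_submod_closed.

Definition cauchy_sequence := {u : nat -> V | u \in cauchy_sequences}.

HB.instance Definition _ := SubChoice.on cauchy_sequence.
HB.instance Definition _ := [SubChoice_isSubLmodule of cauchy_sequence by <:].

Implicit Types u v w : cauchy_sequence.

Definition lim_dot u v : C :=
  lim (((fun n => dot (val u n) (val v n)) : nat -> C^o) @ \oo).

Let bounded_cauchy u : exists M N, 0 < M /\ forall n, (N <= n)%N -> `|val u n| <= M.
Proof.
have /cauchy_sequencesP /(_ 1 ltr01)[N uN] := valP u.
exists (1 + `|val u N|), N; split=> [|n Nn]; first by rewrite ltr_pwDl.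
rewrite -[val u n](subrK (val u N)) (le_trans (ler_normD _ _)) // lerD2r ltW //.
exact: uN.
Qed.

Lemma cvg_lim_dot u v :
  ((fun n => dot (val u n) (val v n)) : nat -> C^o) @ \oo --> (lim_dot u v : C^o).
Proof.
apply: cauchy_cvgC; apply/cauchy_seqPnear => e e0.
have [Mu [Nu [Mu0 uM]]] := bounded_cauchy u.
have [Mv [Nv [Mv0 vM]]] := bounded_cauchy v.
have /cauchy_sequencesP/(_ (e / 2 / Mv))[|N1 uN] := valP u.
  by rewrite !divr_gt0.
have /cauchy_sequencesP/(_ (e / 2 / Mu))[|N2 vN] := valP v.
  by rewrite !divr_gt0.
exists (maxn (maxn Nu Nv) (maxn N1 N2)) => n m.
rewrite !geq_max => /andP[/andP[n1 n2] /andP[n3 n4]] /andP[/andP[m1 m2] /andP[m3 m4]].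
rewrite dotBB (le_lt_trans (ler_normD _ _)) // (splitr e) ltrD //.
  rewrite (le_lt_trans (norm_dot _ _)) //.
  have := uN n m n3 m3; rewrite ltr_pdivlMr //; apply: le_lt_trans.
  by rewrite ler_wpM2l // vM.
rewrite (le_lt_trans (norm_dot _ _)) // mulrC.
have := vN n m n4 m4; rewrite ltr_pdivlMr //; apply: le_lt_trans.
by rewrite ler_wpM2l // uM.
Qed.

Let lim_dot_eq u v (z : nat -> C^o) (l : C^o) :
  (forall n, z n = dot (val u n) (val v n)) -> z @ \oo --> l ->
  lim_dot u v = l.
Proof.
move=> /funext -> zl; apply: (cvg_lim _ zl); exact: norm_hausdorff.
Qed.

Let lim_dotDr u v w : lim_dot u (v + w) = lim_dot u v + lim_dot u w.
Proof.
apply: lim_dot_eq (cvgD (@cvg_lim_dot u v) (@cvg_lim_dot u w)) => n /=.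
by apply/esym; exact: dotDr.
Qed.

Let lim_dotZr k u v : lim_dot u (k *: v) = k * lim_dot u v.
Proof.
have h : ((fun n => k * dot (val u n) (val v n)) : nat -> C^o) @ \oo -->
    (k * lim_dot u v : C^o).
  by apply: (@cvgZ C C^o); [exact: cvg_cst|exact: cvg_lim_dot].
by apply: lim_dot_eq h => n /=; apply/esym; exact: dotZr.
Qed.

Let lim_dotC u v : (lim_dot u v)^* = lim_dot v u.
Proof.
apply/esym; apply: lim_dot_eq (fun=> erefl) _; apply/cvgrPdist_lt => e e0.
have /cvgrPdist_lt/(_ e e0) := @cvg_lim_dot u v.
by apply: filterS => n /=; rewrite -[dot (val v n) _]dotC -rmorphB norm_conjC.
Qed.

Let lim_ge0 (z : nat -> C^o) (l : C^o) :
  (\forall n \near \oo, 0 <= z n) -> z @ \oo --> l -> 0 <= l.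
Proof.
move=> z0 zl; suff h : z @ \oo --> (`|l| : C^o).
  have -> : l = (`|l| : C^o) by exact: (cvg_unique (@norm_hausdorff _ C^o) zl h).
  exact: normr_ge0.
have h : z n @[n --> \oo] `=>` (`|z n| : C^o) @[n --> \oo].
  apply: near_eq_cvg; apply: filterS z0 => n zn0.
  by rewrite ger0_norm.
by apply: cvg_trans h _; exact: (cvg_norm zl).
Qed.

Let lim_dot_ge0 u : 0 <= lim_dot u u.
Proof.
by apply: lim_ge0 (@cvg_lim_dot u u); apply: nearW => n; rewrite dot_ge0.
Qed.

Definition lim_semi_inner_product : semi_inner_product cauchy_sequence :=
  SemiInnerProduct lim_dotDr lim_dotZr lim_dotC lim_dot_ge0.

(* Cauchy sequences modulo those whose norm tends to 0 *)
Definition completion := null_quotient lim_semi_inner_product.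

HB.instance Definition _ := PreHilbert.on completion.

Fact const_cauchy_subproof x : (fun=> x) \in cauchy_sequences.
Proof.
by apply/cauchy_sequencesP => e e0; exists 0%N => n m _ _; rewrite subrr normr0.
Qed.

Definition const_cauchy x : cauchy_sequence := exist _ (fun=> x) (const_cauchy_subproof x).

Definition to_completion x : completion :=
  to_null_quotient lim_semi_inner_product (const_cauchy x).

Fact to_completion_is_linear : linear to_completion.
Proof.
move=> k x y; rewrite /to_completion -linearP; congr to_null_quotient.
exact/val_inj.
Qed.

HB.instance Definition _ :=
  GRing.isLinear.Build C V completion *:%R to_completion to_completion_is_linear.

Lemma dot_completion x y : dot (to_completion x) (to_completion y) = dot x y.
Proof.
rewrite dot_null_quotient; apply: (lim_dot_eq (z := fun=> (dot x y : C^o))) => //.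
exact: cvg_cst.
Qed.

Lemma norm_completion x : `|to_completion x| = `|x|.
Proof.
by apply/eqP; rewrite -(@eqrXn2 _ 2) // !sqr_norm_dot dot_completion.
Qed.

Let dist_completion u x N e : 0 <= e ->
  (forall n, (N <= n)%N -> `|val u n - x| <= e) ->
  `|to_null_quotient lim_semi_inner_product u - to_completion x| <= e.
Proof.
move=> e0 ue; rewrite /to_completion -raddfB norm_null_quotient.
rewrite -(@ler_pXn2r _ 2) ?nnegrE ?snorm_ge0 // sqr_snorm -subr_ge0.
set w := u - _.
have h : ((fun n => e ^+ 2 - dot (val w n) (val w n)) : nat -> C^o) @ \oo -->
    (e ^+ 2 - lim_dot w w : C^o).
  by apply: (@cvgB C C^o); [exact: cvg_cst|exact: cvg_lim_dot].
apply: lim_ge0 h; exists N => // n Nn /=.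
rewrite subr_ge0 -sqr_norm_dot ler_pXn2r ?nnegrE //; exact: ue.
Qed.

Lemma dense_completion (q : completion) (e : C) :
  0 < e -> exists x, `|q - to_completion x| < e.
Proof.
move=> e0; have [u ->] := null_quotient_surj q.
have /cauchy_sequencesP/(_ (e / 2))[|N uN] := valP u; first by rewrite divr_gt0.
exists (val u N); apply: (@le_lt_trans _ _ (e / 2)).
  by apply: (@dist_completion _ _ N); rewrite ?divr_ge0 ?ltW // => n Nn; rewrite ltW // uN.
by rewrite ltr_pdivrMr // mulrDr mulr1 ltrDl.
Qed.

Let completion_complete (F : set_system completion) :
  ProperFilter F -> cauchy F -> cvg F.
Proof.
move=> FF /cauchy_ballP cF.
pose r (n : nat) : C := n.+1%:R^-1.
have r0 n : 0 < r n by rewrite invr_gt0 ltr0n.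
have rlt (e : C) : 0 < e -> exists N, forall n, (N <= n)%N -> r n < e.
  move=> /Re_gt0[e0 eE]; exists (Num.trunc (complex.Re e)^-1) => n Nn.
  rewrite eE /r -(rmorph_nat (real_complex R)) -fmorphV ltcR.
  rewrite invf_plt ?posrE ?ltr0n //.
  rewrite (lt_le_trans (truncnS_gt _)) // ler_nat ltnS //.
have exv n : exists x, F (ball (to_completion x) (r n)).
  have e20 : 0 < r n / 2 by rewrite divr_gt0.
  have : exists y, F (ball y (r n / 2)).
    have [[P Q] /= [FP FQ] PQ] := cF _ e20.
    have [y Py] := filter_ex FP; exists y; apply: filterS FQ => z Qz.
    exact: (PQ (y, z)).
  move=> [y Fy]; have [x yx] := dense_completion y e20; exists x.
  apply: filterS Fy => z; rewrite -!ball_normE /= => yz.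
  rewrite -[to_completion x](subrK y) -addrA (le_lt_trans (ler_normD _ _)) //.
  by rewrite (splitr (r n)) ltrD // distrC.
have [v Fv] := choice exv.
have vv n m : `|v n - v m| < r n + r m.
  rewrite -norm_completion raddfB /=.
  have [z] := filter_ex (filterI (Fv n) (Fv m)).
  rewrite -!ball_normE /= => -[vn vm].
  rewrite -[to_completion (v n)](subrK z) -addrA.
  by rewrite (le_lt_trans (ler_normD _ _)) // ltrD // distrC.
have vC : v \in cauchy_sequences.
  apply/cauchy_sequencesP => e e0; have [|N rN] := rlt (e / 2).
    by rewrite divr_gt0.
  exists N => n m Nn Nm; rewrite (lt_trans (vv n m)) // (splitr e).
  by rewrite ltrD // rN.
pose w : cauchy_sequence := exist _ v vC.
apply/cvg_ex; exists (to_null_quotient lim_semi_inner_product w).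
apply/cvgrPdist_lt => e e0.
have [|N rN] := rlt (e / 3); first by rewrite divr_gt0.
apply: filterS (Fv N) => z; rewrite -ball_normE /= => vz.
rewrite -(subrK (to_completion (v N)) (to_null_quotient _ w)) -addrA.
rewrite (le_lt_trans (ler_normD _ _)) //.
have -> : e = (e / 3 + e / 3) + e / 3 by field.
rewrite ler_ltD //.
  apply: (@dist_completion _ _ N); first by rewrite addr_ge0 // divr_ge0 // ltW.
  by move=> n Nn; rewrite ltW // (lt_trans (vv _ _)) // ltrD // rN.
by rewrite (lt_trans vz) // rN.
Qed.

HB.instance Definition _ :=
  Uniform_isComplete.Build completion completion_complete.

End Completion.

Section Localization.
Context {R : realType} {A : cstarAlgType R} (E : hilbertModType A).
Context (omega : positive_functional A).
Local Notation C := R[i].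
Implicit Types x y z : E.

Let form x y : C := omega (ip x y).

Let formDr x y z : form x (y + z) = form x y + form x z.
Proof. by rewrite /form ipDr raddfD. Qed.

Let formZr (k : C) x y : form x (k *: y) = k * form x y.
Proof. by rewrite /form ipZr linearZ. Qed.

Let form_ge0 x : 0 <= form x x.
Proof. exact/functional_ge0/ip_ge0. Qed.

Let formDl x y z : form (x + y) z = form x z + form y z.
Proof. by rewrite /form -star_ip ipDr starD !star_ip raddfD. Qed.

Let formZl (k : C) x y : form (k *: x) y = k^* * form x y.
Proof. by rewrite /form -star_ip ipZr starZ star_ip linearZ. Qed.

Let formC x y : (form x y)^* = form y x.
Proof.
have realE z : (form z z)^* = form z z by exact/CrealP/ger0_real/form_ge0.
have := realE (x + y); rewrite !(formDl, formDr) !rmorphD /= !realE => h1.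
have := realE (x + 'i *: y).
rewrite !(formDl, formDr, formZl, formZr) !rmorphD /= !rmorphM /= conjCi !realE.
rewrite rmorphN /= conjCi opprK => h2.
have i2 : 'i * 'i = -1 :> C by rewrite -expr2 sqrCi.
have /eqP := h1; rewrite -subr_eq0 => /eqP {}h1.
have /eqP := h2; rewrite -subr_eq0 => /eqP {}h2.
apply/eqP; rewrite -subr_eq0 -(mulrI_eq0 _ (mulfI _) (x := 2)) ?pnatr_eq0 //.
rewrite -[X in _ == X](addr0 0) -[X in _ == X + _]h1.
rewrite -[X in _ == _ + X](mulr0 'i) -[X in _ == _ + _ * X]h2.
by apply/eqP; ring: i2.
Qed.

Definition localization_form : semi_inner_product E :=
  SemiInnerProduct formDr formZr formC form_ge0.

(* The null space of localization_form is [set x | omega (ip x x) = 0]. *)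
Definition localization := completion (null_quotient localization_form).

HB.instance Definition _ := Hilbert.on localization.

Definition iota_loc x : localization :=
  to_completion (to_null_quotient localization_form x).

Fact iota_loc_is_linear : linear iota_loc.
Proof. by move=> k x y; rewrite /iota_loc !linearP. Qed.

HB.instance Definition _ :=
  GRing.isLinear.Build C E localization *:%R iota_loc iota_loc_is_linear.

Lemma dot_iota_loc x y : dot (iota_loc x) (iota_loc y) = omega (ip x y).
Proof. by rewrite dot_completion dot_null_quotient. Qed.

Lemma dense_iota_loc (q : localization) (e : C) :
  0 < e -> exists x, `|q - iota_loc x| < e.
Proof.
move=> e0; have [p qp] := dense_completion q e0.
by have [x px] := null_quotient_surj p; exists x; rewrite /iota_loc -px.
Qed.

Definition localize (L : set E) : set localization := closure (iota_loc @` L).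

End Localization.

Arguments iota_loc {R A E} omega x.
Arguments localize {R A E} omega L.

(* The localization is only defined for a positive_functional; by this lemma,
   every element of a convex hull of such functionals is one. *)
Lemma convex_hull_positive_functional (R : realType) (A : cstarAlgType R)
    (S : set (A -> R[i]^o)) (f : A -> R[i]^o) :
  (forall g, S g -> exists omega : positive_functional A, g = omega) ->
  convex_hull S f -> exists omega : positive_functional A, f = omega.
Proof.
pose P : set (A -> R[i]^o) :=
  [set g : A -> R[i]^o | exists omega : positive_functional A, g = omega].
move=> SP /(_ P); apply; split; last exact: SP.
move=> f1 f2 t; rewrite !inE => -[o1 ->] [o2 ->].
pose g (a : A) : R[i] := t%:num * o1 a + (1 - t%:num) * o2 a.
have gE a : g a = t%:num * o1 a + (1 - t%:num) * o2 a by [].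
suff [o go] : exists o : positive_functional A, g = o by exists o; exact: go.
have gl : scalar g.
  by move=> k a b; rewrite !gE !linearP /=; ring.
have [h hE] : exists h : {scalar A}, g = h.
  pose m := GRing.isLinear.Build R[i] A R[i] *%R g gl.
  by exists (HB.pack_for {scalar A} g m).
have h0 a : cstar_ge0 a -> 0 <= h a.
  move=> a0; have t0 : 0 <= t%:num := ge0 t; have t1 : t%:num <= 1 := le1 t.
  by rewrite -hE gE addr_ge0 // mulr_ge0 ?functional_ge0 // subr_ge0.
by exists (PositiveFunctional h0).
Qed.

(* Main.v *)
(* Let M be the intersection of H and K.  As M is complemented, the orthogonal
   projection onto M contracts every seminorm omega(<x, x>)^(1/2).  Hence the
   equality of localizations at omega says: if (u_n) in H and (v_n) in K are
   orthogonal to M, (u_n) is omega-Cauchy and u_n - v_n is omega-null, then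
   (u_n) is omega-null; indeed the common limit of u_n and v_n lies in H_omega
   and K_omega, hence in M_omega, to which it is orthogonal.  This criterion
   passes to f = t f1 + (1 - t) f2: f dominates t f1 and (1 - t) f2, so the
   sequences satisfy the premises at each f_i of positive weight, and those of
   weight zero do not contribute to f. *)
Require Import Defs.
From HB Require Import structures.
From mathcomp Require Import all_boot all_order all_algebra complex.
From mathcomp Require Import boolp classical_sets functions reals.
From mathcomp Require Import interval_inference convex topology normedtype.

Set Implicit Arguments.
Unset Strict Implicit.
Unset Printing Implicit Defensive.

Import Order.TTheory GRing.Theory Num.Theory.
Import numFieldNormedType.Exports.

Local Open Scope classical_set_scope.
Local Open Scope ring_scope.

(** * Quantities tending to zero along a filter *)

Section Vanishing.
Context {R : realType} {T : Type} (F : set_system T) {FF : Filter F}.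
Local Notation C := R[i].
Implicit Types (r s : T -> C) (t : C).

(** The bound is one-sided: for nonnegative [s] this is convergence to 0. *)
Definition vanishes s := forall e : C, 0 < e -> \forall x \near F, s x < e.

Lemma vanishes_dominated t r s :
  0 < t -> (forall x, t * r x <= s x) -> vanishes s -> vanishes r.
Proof.
move=> t0 rs s0 e e0; apply: filterS (s0 (t * e) (mulr_gt0 t0 e0)) => x.
by move=> sx; rewrite -(ltr_pM2l t0) (le_lt_trans (rs x)).
Qed.

Lemma vanishesD r s : vanishes r -> vanishes s -> vanishes (r \+ s).
Proof.
move=> r0 s0 e e0; have e20 : 0 < e / 2 by rewrite divr_gt0.
apply: filterS2 (r0 _ e20) (s0 _ e20) => x rx sx.
by rewrite (splitr e) ltrD.
Qed.

(** The guard [0 < t] absorbs weight zero, where the product is 0 whatever [r] does. *)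
Lemma vanishesZ t r : 0 <= t -> (0 < t -> vanishes r) -> vanishes (t \*o r).
Proof.
rewrite le_eqVlt => /predU1P[<- _|t0 /(_ t0) r0] e e0.
  by apply: nearW => x /=; rewrite mul0r.
apply: filterS (r0 (t^-1 * e) _) => [x|]; last by rewrite mulr_gt0 // invr_gt0.
by rewrite /= ltr_pdivlMl.
Qed.

Lemma vanishes_sqr s : (forall x, 0 <= s x) ->
  vanishes (fun x => s x ^+ 2) <-> vanishes s.
Proof.
move=> s0; split=> h e e0.
  apply: filterS (h (e ^+ 2) (exprn_gt0 _ e0)) => x.
  by rewrite ltr_pXn2r ?nnegrE // ltW.
have q0 : 0 < sqrtC e by rewrite sqrtC_gt0.
apply: filterS (h (sqrtC e) q0) => x.
by rewrite -{2}(sqrtCK e) ltr_pXn2r ?nnegrE // ltW.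
Qed.

End Vanishing.

(** * The sequence criterion and its convexity *)

Section Separation.
Context {R : realType} {A : cstarAlgType R} {E : hilbertModType A}.
Local Notation C := R[i].
Implicit Types (f g : A -> C^o) (L N : set E) (u v : nat -> E).

Definition ip_cauchy f u := vanishes (filter_prod \oo \oo)
  (fun p : nat * nat => f (ip (u p.1 - u p.2) (u p.1 - u p.2))).

Definition ip_null f u := vanishes \oo (fun n => f (ip (u n) (u n))).

(* For a complemented [H `&` K], the equality of localizations amounts to
   [separated omega L N], with [L] and [N] the parts of [H] and [K] orthogonal
   to [H `&` K]. *)
Definition separated f L N := forall u v,
  (forall n, L (u n)) -> (forall n, N (v n)) ->
  ip_cauchy f u -> ip_null f (u \- v) -> ip_null f u.

(** Plain functions, since the convex hull is formed in the space of all maps [A -> C^o]; positivity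
    is recorded because domination relies on it. *)
Definition separating L N : set (A -> C^o) :=
  [set f : A -> C^o | (forall a, cstar_ge0 a -> 0 <= f a) /\ separated f L N].

Lemma convex_separating L N : convex_set (separating L N).
Proof.
move=> f1 f2 t; rewrite !inE => -[p1 s1] [p2 s2].
have t0 : 0 <= t%:num :> C := ge0 t.
have t1 : 0 <= 1 - t%:num :> C by rewrite subr_ge0; exact: (le1 t).
pose f a : C := t%:num * f1 a + (1 - t%:num) * f2 a.
suff : separating L N f by exact.
have le1f a : cstar_ge0 a -> t%:num * f1 a <= f a.
  by move=> a0; rewrite lerDl mulr_ge0 // p2.
have le2f a : cstar_ge0 a -> (1 - t%:num) * f2 a <= f a.
  by move=> a0; rewrite lerDr mulr_ge0 // p1.
split=> [a a0|u v Lu Nv uC uv0].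
  by rewrite addr_ge0 // mulr_ge0 ?p1 ?p2.
(* Here [s0] says that the weight of the summand is positive, so domination by [f] transfers both
   premises to that summand. *)
apply: vanishesD; apply: vanishesZ => // s0.
  apply: (s1 u v) => //; [move: uC|move: uv0]; apply: vanishes_dominated s0 _.
    by move=> p; exact/le1f/ip_ge0.
  by move=> n; exact/le1f/ip_ge0.
apply: (s2 u v) => //; [move: uC|move: uv0]; apply: vanishes_dominated s0 _.
  by move=> p; exact/le2f/ip_ge0.
by move=> n; exact/le2f/ip_ge0.
Qed.

End Separation.

Section SubmoduleDifferences.
Context {R : realType} {A : cstarAlgType R} {E : hilbertModType A}.
Implicit Types (x y : E) (L : set E).

Lemma star0 : star (0 : A) = 0.
Proof. by rewrite -(scale0r (0 : A)) starZ rmorph0 !scale0r. Qed.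

Lemma submoduleB L x y : closed_submodule L -> L x -> L y -> L (x - y).
Proof.
by move=> [_ LZ _ _] Lx Ly; rewrite addrC -scaleN1r; exact: LZ.
Qed.

Lemma orthogonal_complementB L x y : orthogonal_complement L x ->
  orthogonal_complement L y -> orthogonal_complement L (x - y).
Proof.
move=> Lx Ly l Ll; rewrite -star_ip addrC -scaleN1r ipDr ipZr -!(star_ip _ l).
by rewrite Lx // Ly // star0 scaler0 addr0 star0.
Qed.

End SubmoduleDifferences.

(** * Localizations described by sequences *)

Section LocalizationSequences.
Context {R : realType} {A : cstarAlgType R} {E : hilbertModType A}.
Context (omega : positive_functional A).
Local Notation C := R[i].
Local Notation iota := (iota_loc (E := E) omega).
Implicit Types (x y : E) (L : set E) (u v : nat -> E).

Lemma sqr_norm_iota_loc x : `|iota x| ^+ 2 = omega (ip x x).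
Proof. by rewrite sqr_norm_dot dot_iota_loc. Qed.

Lemma iota_locB x y : iota (x - y) = iota x - iota y.
Proof. exact: raddfB. Qed.

Lemma ip_nullP u : ip_null omega u <-> vanishes \oo (fun n => `|iota (u n)|).
Proof.
rewrite -vanishes_sqr // /ip_null.
by rewrite (_ : (fun n => _) = (fun n => `|iota (u n)| ^+ 2)) //;
  apply/funext => n; rewrite sqr_norm_iota_loc.
Qed.

Lemma ip_cauchyP u : ip_cauchy omega u <-> cauchy ((iota \o u) @ \oo).
Proof.
rewrite /ip_cauchy (_ : (fun p => _) =
  (fun p : nat * nat => `|iota (u p.1) - iota (u p.2)| ^+ 2)); last first.
  by apply/funext => p; rewrite -iota_locB sqr_norm_iota_loc.
rewrite vanishes_sqr // -(cauchy_ballP ((iota \o u) @ \oo)).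
split=> h e e0.
  rewrite near_simpl; apply: filterS (h e e0) => p.
  by rewrite -ball_normE.
by have := h e e0; rewrite near_simpl; apply: filterS => p; rewrite -ball_normE.
Qed.

Lemma cvg_localize L (u : nat -> E) (q : localization E omega) :
  (forall n, L (u n)) -> (iota \o u) @ \oo --> q -> localize omega L q.
Proof.
move=> Lu uq B /uq uB.
have [n Bn] : exists n, B (iota (u n)) by exact: (@filter_ex _ \oo _ _ uB).
by exists (iota (u n)); split=> //; exists (u n).
Qed.

Lemma localize_cvg L (q : localization E omega) :
  localize omega L q ->
  exists2 u : nat -> E, (forall n, L (u n)) & (iota \o u) @ \oo --> q.
Proof.
move=> Lq.
have H (n : nat) : exists x, L x /\ `|q - iota x| < n.+1%:R^-1.
  have [|_ [[x Lx <-]]] := Lq (ball q n.+1%:R^-1).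
    by apply: nbhsx_ballx; rewrite invr_gt0.
  by rewrite -ball_normE; exists x.
have [u Hu] := choice H; exists u => [n|]; first by have [] := Hu n.
apply/cvgrPdist_lt => e /Re_gt0[e0 eE].
(* From this index on, [n.+1] exceeds the inverse of [e]. *)
exists (Num.trunc (complex.Re e)^-1) => // n /= Nn.
have [_ /lt_le_trans->//] := Hu n.
rewrite eE -(rmorph_nat (real_complex R)) -fmorphV lecR.
rewrite invf_ple ?posrE ?ltr0n //.
by rewrite ltW // (lt_le_trans (truncnS_gt _)) // ler_nat.
Qed.

Lemma localizeS L (N : set E) :
  L `<=` N -> localize omega L `<=` localize omega N.
Proof. by move=> LN; apply: closure_subset; exact: image_subset. Qed.

(** Pythagoras: the cross terms vanish and [omega (ip y y)] is nonnegative. *)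
Lemma norm_iota_loc_orthogonal x y :
  ip x y = 0 -> `|iota x| <= `|iota (x + y)|.
Proof.
move=> xy0.
have le_sqr (a b : C) : 0 <= a -> 0 <= b -> a ^+ 2 <= b ^+ 2 -> a <= b.
  by move=> a0 b0; rewrite ler_pXn2r ?nnegrE.
apply: le_sqr (normr_ge0 _) (normr_ge0 _) _; rewrite !sqr_norm_iota_loc.
have -> : ip (x + y) (x + y) = ip x x + ip y y.
  rewrite -star_ip ipDr starD !star_ip !ipDr xy0.
  by rewrite -[ip y x]star_ip xy0 star0 addr0 add0r.
by rewrite linearD lerDl; exact/functional_ge0/ip_ge0.
Qed.

End LocalizationSequences.

(** * Equality of localizations versus separation *)

Section Complemented.
Context {R : realType} {A : cstarAlgType R} {E : hilbertModType A}.
Context (H K : set E).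
Hypotheses (closedH : closed_submodule H) (closedK : closed_submodule K).
Hypothesis complHK : orthogonally_complemented (H `&` K).
Context (omega : positive_functional A).
Local Notation C := R[i].
Local Notation iota := (iota_loc (E := E) omega).
Local Notation M := (H `&` K).
Local Notation Mperp := (orthogonal_complement M).

Lemma localize_eq_separated :
  localize omega M = localize omega H `&` localize omega K ->
  separated omega (H `&` Mperp) (K `&` Mperp).
Proof.
move=> eqM u v Hu Kv /ip_cauchyP uC /ip_nullP uv0; apply/ip_nullP.
have /cvg_ex[q uq] : cvg ((iota \o u) @ \oo) by exact: cauchy_cvg.
have vq : (iota \o v) @ \oo --> q.
  apply/cvgrPdist_lt => e e0; have e20 : 0 < e / 2 by rewrite divr_gt0.
  move/cvgrPdist_lt: uq => /(_ _ e20) uq.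
  apply: filterS2 uq (uv0 _ e20) => n qn uvn.
  by apply: distm_lt_split qn _; rewrite -iota_locB.
have Mq : localize omega M q.
  rewrite eqM; split; [apply: cvg_localize uq|apply: cvg_localize vq].
    by move=> n; have [] := Hu n.
  by move=> n; have [] := Kv n.
have [m Mm mq] := localize_cvg Mq.
move=> e e0; have e20 : 0 < e / 2 by rewrite divr_gt0.
move/cvgrPdist_lt: uq => /(_ _ e20) uq.
move/cvgrPdist_lt: mq => /(_ _ e20) mq.
apply: filterS2 uq mq => n qu qm.
(* Orthogonality bounds [iota (u n)] by [iota (u n - m n)], which tends to [q - q]. *)
have um0 : ip (u n) (- m n) = 0.
  by have [_ /(_ _ (Mm n)) um] := Hu n; rewrite -scaleN1r ipZr um scaler0.
rewrite (le_lt_trans (norm_iota_loc_orthogonal _ um0)) // iota_locB.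
exact: distm_lt_splitr qu qm.
Qed.

(** Approximate a common point from [H] and from [K]: separation makes the components orthogonal to
    [M] null, so the components in [M] have the same limit. *)
Lemma separated_localize_eq : separated omega (H `&` Mperp) (K `&` Mperp) ->
  localize omega M = localize omega H `&` localize omega K.
Proof.
move=> sep; apply/seteqP; split=> [q Mq|q [Hq Kq]].
  by split; move: Mq; apply: localizeS => x [].
have [decM _] := complHK.
have [P decP] := choice decM; have [Q {}decP] := choice decP.
have MP x : M (P x) by have [] := decP x.
have pQ x : Mperp (Q x) by have [] := decP x.
have QE x : Q x = x - P x by have [_ _ {2}->] := decP x; rewrite addrC addKr.
(* [P] and [Q] are chosen pointwise, so contraction is proved on differences directly: [Q x - Q y]
   is orthogonal to [P x - P y], and they sum to [x - y]. *)
have QB x y : `|iota (Q x - Q y)| <= `|iota (x - y)|.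
  have <- : (Q x - Q y) + (P x - P y) = x - y.
    by rewrite addrACA -opprD !QE !subrK.
  apply: norm_iota_loc_orthogonal; apply: orthogonal_complementB => //.
  by split; apply: submoduleB => //; have [] := MP x; have [] := MP y.
have [u Hu uq] := localize_cvg Hq; have [v Kv vq] := localize_cvg Kq.
have Q0 : vanishes \oo (fun n => `|iota (Q (u n))|).
  apply/ip_nullP/(sep (Q \o u) (Q \o v)) => [n|n||].
  (* [Q (u n)] stays in [H] because [P (u n)] lies in [M], hence in [H]. *)
  - by split; rewrite //= QE; apply: submoduleB => //; have [] := MP (u n).
  - by split; rewrite //= QE; apply: submoduleB => //; have [] := MP (v n).
  - have /cauchy_ballP uC : cauchy ((iota \o u) @ \oo).
      exact: cvg_cauchy (cvgP _ uq).
    apply/ip_cauchyP/cauchy_ballP => e e0; have := uC e e0.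
    rewrite !near_simpl; apply: filterS => p; rewrite -ball_normE /=.
    by rewrite -!iota_locB; apply: le_lt_trans.
  apply/ip_nullP => e e0; have e20 : 0 < e / 2 by rewrite divr_gt0.
  move/cvgrPdist_lt: uq => /(_ _ e20) uq.
  move/cvgrPdist_lt: vq => /(_ _ e20) vq.
  apply: filterS2 uq vq => n qu qv; rewrite (le_lt_trans (QB _ _)) //.
  by rewrite iota_locB; exact: distm_lt_splitr qu qv.
apply: (cvg_localize (u := P \o u)) => [n|]; first exact: MP.
apply/cvgrPdist_lt => e e0; have e20 : 0 < e / 2 by rewrite divr_gt0.
move/cvgrPdist_lt: uq => /(_ _ e20) uq.
apply: filterS2 uq (Q0 _ e20) => n qu qn.
by apply: distm_lt_split qu _; rewrite -iota_locB -QE.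
Qed.

End Complemented.

Theorem corollary2p4 (R : realType) (A : cstarAlgType R)
    (E : hilbertModType A) (H K : set E)
    (closedH : closed_submodule H) (closedK : closed_submodule K)
    (complHK : orthogonally_complemented (H `&` K))
    (n : nat) (omega_ : 'I_n -> positive_functional A)
    (loc_omega : forall j : 'I_n,
      localize (omega_ j) (H `&` K) =
      localize (omega_ j) H `&` localize (omega_ j) K)
    (omega : positive_functional A)
    (hull_omega : convex_hull
      [set (omega_ j : A -> R[i]^o) | j in [set: 'I_n]]
      (omega : A -> R[i]^o)) :
  localize omega (H `&` K) = localize omega H `&` localize omega K.
Proof.
set Mp := orthogonal_complement (H `&` K).
apply: separated_localize_eq => //.
suff [] : separating (H `&` Mp) (K `&` Mp) omega by [].
(* The hull is the smallest convex set containing the generators, so it lies in [separating]. *)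
apply: hull_omega; split; first exact: convex_separating.
move=> _ [j _ <-]; split; first exact: functional_ge0.
exact: localize_eq_separated.
Qed.
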